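(* Let $(M,\omega)$ be a two-dimensional symplectic manifold (not necessarily closed). Then for all $F,G\in C^\infty(M)$, $$\Upsilon(F,G)=\|\{F,G\}\|,$$ where $$\Upsilon(F,G)=\lim_{\varepsilon\to 0^+}\ \inf\big\{\|\{F',G'\}\| \ \big|\ F',G'\in C^\infty(M),\ \|F-F'\|<\varepsilon,\ \|G-G'\|<\varepsilon\big\}.$$
   Context: $\|\cdot\|$ denotes the supremum norm over $M$, taking values in $[0,\infty]$: if $\{F,G\}$ is unbounded then $\|\{F,G\}\|=\infty$, and the equality then asserts $\Upsilon(F,G)=\infty$. The Poisson bracket of $F,G\in C^\infty(M)$ on a two-dimensional symplectic manifold is the function $\{F,G\}$ determined by $-dF\wedge dG=\{F,G\}\,\omega$. *)

(* Defs.v *)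
From mathcomp Require Import all_boot all_order all_algebra.
From mathcomp Require Import all_classical all_reals all_analysis.
From mathcomp Require Import lra.

Set Implicit Arguments.
Unset Strict Implicit.
Unset Printing Implicit Defensive.

Import Order.TTheory GRing.Theory Num.Theory.
Import numFieldNormedType.Exports.

Local Open Scope classical_set_scope.
Local Open Scope ring_scope.

(* Only used for an open set [U]: the values of [f] and ['D_v f] outside of [U]
   are then irrelevant. *)
Fixpoint Ck_on (R : realType) (n : nat) (W : normedModType R) (k : nat)
    (U : set 'rV[R]_n) (f : 'rV[R]_n -> W) : Prop :=
  if k is k'.+1 then
    (forall x, U x -> differentiable f x) /\
    (forall v, Ck_on k' U (fun x => 'D_v f x))
  else {in U, continuous f}.

Definition Csmooth_on (R : realType) (n : nat) (W : normedModType R)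
    (U : set 'rV[R]_n) (f : 'rV[R]_n -> W) : Prop :=
  forall k, Ck_on k U f.

(* Both maps of a chart are total functions; [chart_map] is only meaningful on
   [chart_dom] and [chart_inv] on the image of [chart_dom]. *)
Record chart (R : realType) (n : nat) (M : topologicalType) := Chart {
  chart_dom : set M;
  chart_map :> M -> 'rV[R]_n;
  chart_inv : 'rV[R]_n -> M;
  chart_dom_open : open chart_dom;
  chart_cod_open : open (chart_map @` chart_dom);
  chart_mapK : {in chart_dom, cancel chart_map chart_inv};
  chart_map_cont : {in chart_dom, continuous chart_map};
  chart_inv_cont : {in chart_map @` chart_dom, continuous chart_inv} }.

Definition chart_cod (R : realType) (n : nat) (M : topologicalType)
    (c : chart R n M) : set 'rV[R]_n := c @` chart_dom c.

Definition transition (R : realType) (n : nat) (M : topologicalType)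
    (c d : chart R n M) : 'rV[R]_n -> 'rV[R]_n := d \o chart_inv c.

(* The atlas need not be maximal: it has the same smooth functions and forms as
   the maximal atlas that contains it. *)
Record smooth_manifold (R : realType) (n : nat) (M : topologicalType) :=
  SmoothManifold {
  atlas : set (chart R n M);
  manifold_hausdorff : hausdorff_space M;
  manifold_second_countable : @second_countable M;
  atlas_cover : forall p : M, exists2 c, atlas c & chart_dom c p;
  atlas_compatible : forall c d, atlas c -> atlas d ->
    Csmooth_on (c @` (chart_dom c `&` chart_dom d)) (transition c d) }.

Definition smooth_fun (R : realType) (n : nat) (M : topologicalType)
    (A : smooth_manifold R n M) (F : M -> R) : Prop :=
  forall c, atlas A c -> Csmooth_on (chart_cod c) (F \o chart_inv c).

(* [form c p] is the Gram matrix of the 2-form at [p] in the coordinate basis of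
   [c]: tangent vectors with coordinates [v] and [w] are sent to
   [v *m form c p *m w^T].  The library's ['J f x] acts on row vectors from the
   right, ['d f x v = v *m 'J f x], whence the shape of [form_change]. *)
Record symplectic_form (R : realType) (n : nat) (M : topologicalType)
    (A : smooth_manifold R n M) := SymplecticForm {
  form :> chart R n M -> M -> 'M[R]_n;
  form_change : forall c d p, atlas A c -> atlas A d ->
    chart_dom c p -> chart_dom d p ->
    form c p =
      'J (transition c d) (c p) *m form d p *m ('J (transition c d) (c p))^T;
  form_smooth : forall c, atlas A c ->
    forall i j, Csmooth_on (chart_cod c) (fun x => form c (chart_inv c x) i j);
  form_alternating : forall c p, atlas A c -> chart_dom c p ->
    (form c p)^T = - form c p;
  form_nondegenerate : forall c p, atlas A c -> chart_dom c p ->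
    form c p \in unitmx;
  form_closed : forall c x, atlas A c -> chart_cod c x -> forall i j k,
    'D_(delta_mx 0 i) (fun y => form c (chart_inv c y) j k : R) x +
    'D_(delta_mx 0 j) (fun y => form c (chart_inv c y) k i : R) x +
    'D_(delta_mx 0 k) (fun y => form c (chart_inv c y) i j : R) x = 0 }.

Definition dfun (R : realType) (n : nat) (M : topologicalType)
    (F : M -> R) (c : chart R n M) (p : M) : 'rV[R]_n :=
  \row_i 'D_(delta_mx 0 i) (F \o chart_inv c) (c p).

(* No factor 1/2: (a /\ b)(v, w) = a(v) b(w) - a(w) b(v). *)
Definition wedge (R : realType) (n : nat) (a b : 'rV[R]_n) : 'M[R]_n :=
  a^T *m b - b^T *m a.

Definition is_poisson (R : realType) (M : topologicalType)
    (A : smooth_manifold R 2 M) (w : symplectic_form A) (F G H : M -> R) :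
    Prop :=
  forall c p, atlas A c -> chart_dom c p ->
    - wedge (dfun F c p) (dfun G c p) = H p *: w c p.

Definition poisson (R : realType) (M : topologicalType)
    (A : smooth_manifold R 2 M) (w : symplectic_form A) (F G : M -> R) :
    M -> R :=
  get (is_poisson w F G).

(* The 0 only matters when [M] is empty, where the bare supremum is -oo. *)
Definition supnorm (R : realType) (M : Type) (F : M -> R) : \bar R :=
  ereal_sup (0%E |` range (fun p => `|F p|%:E)).

Definition poisson_inf (R : realType) (M : topologicalType)
    (A : smooth_manifold R 2 M) (w : symplectic_form A) (F G : M -> R)
    (e : R) : \bar R :=
  ereal_inf [set y | exists F' G' : M -> R,
    [/\ smooth_fun A F', smooth_fun A G',
        (supnorm (F \- F')%R < e%:E)%E, (supnorm (G \- G')%R < e%:E)%E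
      & y = supnorm (poisson w F' G')]].

Definition Upsilon (R : realType) (M : topologicalType)
    (A : smooth_manifold R 2 M) (w : symplectic_form A) (F G : M -> R) :
    \bar R :=
  lim (poisson_inf w F G e @[e --> 0^'+]).

(* The limit and the definite description above are not junk values. *)

Lemma is_cvg_poisson_inf (R : realType) (M : topologicalType)
    (A : smooth_manifold R 2 M) (w : symplectic_form A) (F G : M -> R) :
  cvg (poisson_inf w F G e @[e --> 0^'+]).
Proof.
apply: nonincreasing_at_right_is_cvge; near=> e => x y _ _ xy.
apply: le_ereal_inf => z [F' [G' [sF sG lF lG ->]]].
by exists F', G'; split => //; [apply: lt_le_trans lF _|apply: lt_le_trans lG _];
  rewrite lee_fin.
Unshelve. all: by end_near. Qed.

Lemma chart_overlap_open (R : realType) (n : nat) (M : topologicalType)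
    (c d : chart R n M) : open (c @` (chart_dom c `&` chart_dom d)).
Proof.
rewrite openE => _ [p [cp dp] <-]; rewrite /interior.
have cx : chart_cod c (c p) by exists p.
have Ec : chart_inv c (c p) = p by rewrite chart_mapK ?in_setE.
have nc : nbhs (c p) (chart_cod c).
  exact: open_nbhs_nbhs (conj (@chart_cod_open _ _ _ c) cx).
have ni : nbhs (c p) (chart_inv c @^-1` chart_dom d).
  apply: chart_inv_cont; first by rewrite in_setE.
  rewrite Ec; exact: open_nbhs_nbhs (conj (@chart_dom_open _ _ _ d) dp).
near=> x.
have [q cq xq] : chart_cod c x by near: x.
have : chart_dom d (chart_inv c x) by near: x.
by rewrite -xq chart_mapK ?in_setE // => dq; exists q.
Unshelve. all: by end_near. Qed.

Lemma dfun_change (R : realType) (n : nat) (M : topologicalType)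
    (A : smooth_manifold R n M) (F : M -> R) c d p :
  smooth_fun A F -> atlas A c -> atlas A d -> chart_dom c p -> chart_dom d p ->
  dfun F c p = dfun F d p *m ('J (transition c d) (c p))^T.
Proof.
move=> sF Ac Ad cp dp.
have Ec : chart_inv c (c p) = p by rewrite chart_mapK ?in_setE.
have Et : transition c d (c p) = d p by rewrite /transition /= Ec.
have dt : differentiable (transition c d) (c p).
  by have [+ _] := atlas_compatible Ac Ad 1%N; apply; exists p.
have dF : differentiable (F \o chart_inv d) (transition c d (c p)).
  by rewrite Et; have [+ _] := sF d Ad 1%N; apply; exists p.
apply/rowP => i; rewrite !mxE.
have -> : 'D_(delta_mx 0 i) (F \o chart_inv c) (c p) =
    'D_(delta_mx 0 i) ((F \o chart_inv d) \o transition c d) (c p).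
  apply: near_eq_derive.
  have : nbhs (c p) (c @` (chart_dom c `&` chart_dom d)).
    apply: open_nbhs_nbhs; split; first exact: chart_overlap_open.
    by exists p.
  apply: filterS => x [q [cq dq] <-] /=.
  by rewrite /transition /= (@chart_mapK _ _ _ c) ?in_setE // chart_mapK ?in_setE.
rewrite deriveE; last exact: differentiable_comp.
rewrite diff_comp //= -(deriveE _ dt) deriveEjacobian // -rowE.
rewrite [X in 'd _ _ X]row_sum_delta linear_sum /=; apply: eq_bigr => j _.
by rewrite linearZ /= -deriveE // Et !mxE mulrC.
Qed.

Lemma wedgeE (R : realType) (n : nat) (a b : 'rV[R]_n) i j :
  wedge a b i j = a 0 i * b 0 j - b 0 i * a 0 j.
Proof. by rewrite /wedge mxE [X in _ + X]mxE !mxE !big_ord1 !mxE. Qed.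

Lemma alternating2E (R : realType) (B : 'M[R]_2) :
  B^T = - B -> B = B 0 1 *: wedge (delta_mx 0 0) (delta_mx 0 1).
Proof.
move=> aB.
have bE i j : B j i = - B i j by have /matrixP/(_ i j) := aB; rewrite !mxE.
have b0 i : B i i = 0 by have := bE i i; lra.
have I2 (i : 'I_2) : i = 0 \/ i = 1.
  by case: i => [[|[|//]] ?]; [left|right]; exact/val_inj.
apply/matrixP => i j; rewrite [RHS]mxE wedgeE [delta_mx _ _ _ i]mxE.
rewrite [delta_mx _ _ _ j]mxE [delta_mx _ _ _ i]mxE [delta_mx _ _ _ j]mxE.
have [->|->] := I2 i; have [->|->] := I2 j; rewrite /= ?b0 ?(bE 0 1);
  by rewrite ?(mulr0, mul0r, mulr1, mul1r) ?subrr ?subr0 ?sub0r ?mulrN1 ?mulr0 ?mulr1.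
Qed.

Lemma form_neq0 (R : realType) (M : topologicalType)
    (A : smooth_manifold R 2 M) (w : symplectic_form A) c p :
  atlas A c -> chart_dom c p -> w c p != 0.
Proof.
move=> Ac cp; apply/eqP => w0.
have := form_nondegenerate w Ac cp.
by rewrite w0 unitmxE det0 unitr0.
Qed.

Lemma poissonP (R : realType) (M : topologicalType)
    (A : smooth_manifold R 2 M) (w : symplectic_form A) (F G : M -> R) :
  smooth_fun A F -> smooth_fun A G -> is_poisson w F G (poisson w F G).
Proof.
move=> sF sG; rewrite /poisson.
have pt (p : M) : {h : R | forall c, atlas A c -> chart_dom c p ->
    - wedge (dfun F c p) (dfun G c p) = h *: w c p}.
  apply: cid; have [d Ad dp] := atlas_cover A p.
  have loc c : atlas A c -> chart_dom c p -> exists h : R,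
      - wedge (dfun F c p) (dfun G c p) = h *: w c p.
    move=> Ac cp; have wE := alternating2E (form_alternating w Ac cp).
    have a0 : w c p 0 1 != 0.
      apply: contra (form_neq0 w Ac cp) => /eqP a0.
      by rewrite wE a0 scale0r.
    set W := - wedge _ _.
    have /alternating2E -> : W^T = - W.
      apply/matrixP => i j; rewrite /W mxE [LHS]mxE [RHS]mxE [in RHS]mxE !wedgeE.
      by rewrite opprK opprB mulrC [X in _ - X]mulrC.
    by exists (W 0 1 / w c p 0 1); rewrite {2}wE scalerA divfK.
  have [h hd] := loc d Ad dp; exists h => c Ac cp.
  rewrite (form_change w Ac Ad cp dp) (dfun_change sF Ac Ad cp dp).
  rewrite (dfun_change sG Ac Ad cp dp) scalemxAl scalemxAr -hd.
  rewrite /wedge mulmxN mulNmx mulmxBr mulmxBl !trmx_mul !trmxK.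
  by rewrite !mulmxA.
apply: (@getPex _ (is_poisson w F G)).
by exists (fun p => sval (pt p)) => c p Ac cp; case: (pt p) => h /=; apply.
Qed.

Lemma is_poisson_unique (R : realType) (M : topologicalType)
    (A : smooth_manifold R 2 M) (w : symplectic_form A) (F G H H' : M -> R) :
  is_poisson w F G H -> is_poisson w F G H' -> H = H'.
Proof.
move=> h h'; apply/funext => p; have [c Ac cp] := atlas_cover A p.
apply/eqP; rewrite -subr_eq0.
have : (H p - H' p) *: w c p = 0.
  by rewrite scalerBl -(h _ _ Ac cp) -(h' _ _ Ac cp) subrr.
by move/eqP; rewrite scaler_eq0 (negPf (form_neq0 w Ac cp)) orbF.
Qed.

(* Main.v *)
Require Import Defs.
From mathcomp Require Import all_boot all_order all_algebra.
From mathcomp Require Import all_classical all_reals all_analysis.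
From mathcomp Require Import ring lra.

Set Implicit Arguments.
Unset Strict Implicit.
Unset Printing Implicit Defensive.

Import Order.TTheory GRing.Theory Num.Theory.
Import numFieldNormedType.Exports.

Local Open Scope classical_set_scope.
Local Open Scope ring_scope.

(* Only the inequality "Upsilon >= sup norm" has content, and it is local.  Let
   {F, G}(p) <> 0 and use the frame at p dual to (dF, dG), so that (F, G) is
   C^1-close to a translation on a small square Q.  If (F', G') is C^0-close to
   (F, G) on Q, it carries opposite sides of Q to curves that are nearly as far
   apart as the sides, hence its Jacobian is nearly at least 1 in absolute value
   somewhere on Q (an inequality of Besicovitch type).  For the latter, clamp
   both components so that f = F' and g = G' are constant on opposite sides of
   Q: Green's formula for f dg on the boundary then gives the integral of the
   Jacobian of (f, g) exactly, whatever the derivatives of F' and G' are.  The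
   formula is only used for Riemann sums over grids. *)

(** * Green's formula for Riemann sums on a rectangle *)

Definition box (R : realType) (a b c d : R) : set (R * R) :=
  `[a, b]%classic `*` `[c, d]%classic.

Definition C1_at (R : realType) (f fx fy : R * R -> R) (p : R * R) :=
  [/\ {for p, continuous f},
      is_derive p.1 1 (fun x => f (x, p.2)) (fx p),
      is_derive p.2 1 (fun y => f (p.1, y)) (fy p),
      {for p, continuous fx} & {for p, continuous fy}].

Lemma norm_mulB (R : realType) (p q P Q e : R) :
  `|p - P| <= e -> `|q - Q| <= e -> e <= 1 ->
  `|p * q - P * Q| <= e * (`|P| + `|Q| + 1).
Proof.
move=> pP qQ e1.
have -> : p * q - P * Q = (p - P) * (q - Q) + P * (q - Q) + (p - P) * Q by ring.
have e0 : 0 <= e by apply: le_trans pP.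
apply: le_trans (ler_normD _ _) _; apply: le_trans (lerD (ler_normD _ _) (lexx _)) _.
rewrite !normrM.
have h1 : `|p - P| * `|q - Q| <= e * 1.
  by apply: ler_pM => //; apply: le_trans qQ e1.
have h2 : `|P| * `|q - Q| <= `|P| * e by apply: ler_wpM2l.
have h3 : `|p - P| * `|Q| <= e * `|Q| by apply: ler_wpM2r.
lra.
Qed.

Lemma MVT_is_derive (R : realType) (f df : R -> R) (a b : R) : a <= b ->
  (forall x, a <= x <= b -> is_derive x 1 f (df x)) ->
  exists2 c, a <= c <= b & f b - f a = df c * (b - a).
Proof.
move=> ab dfP; have [||c] := @MVT_segment R f df a b ab.
- move=> x /andP[ax xb]; apply: dfP; move: ax xb.
  by rewrite !bnd_simp => /ltW -> /ltW ->.
- by apply: derivable_within_continuous => x xab; have [] := dfP x xab.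
- by move=> cab E; exists c.
Qed.

(* The Riemann sum of [f dg] along the boundary of the rectangle with opposite
   corners (x, y) and (x', y'), every edge being evaluated at its lower left
   end: the contributions of an edge to its two neighbours in a grid cancel. *)
Definition cell_sum (R : realType) (f g : R * R -> R) (x y x' y' : R) :=
  (f (x', y) - f (x, y)) * (g (x', y') - g (x', y)) -
  (f (x, y') - f (x, y)) * (g (x', y') - g (x, y')).

(** The mean value theorem turns each of the four increments into a partial derivative at a point of
    the cell times [s] or [t]; continuity of the partial derivatives at [z] does the rest. The joint
    filter in [p] and [h] is what the compactness argument over the box consumes. *)
Lemma cell_sum_le (R : realType) (a b c d : R) (f g fx fy gx gy : R * R -> R)
    (z : R * R) (e : R) :
  (forall p, box a b c d p -> C1_at f fx fy p) ->
  (forall p, box a b c d p -> C1_at g gx gy p) ->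
  box a b c d z -> 0 < e ->
  \forall p \near z & h \near (0 : R)^'+, forall s t,
    0 <= s <= h -> 0 <= t <= h ->
    box a b c d p -> box a b c d (p.1 + s, p.2 + t) ->
    cell_sum f g p.1 p.2 (p.1 + s) (p.2 + t) <=
      (fx z * gy z - fy z * gx z + e) * (s * t).
Proof.
move=> Cf Cg Kz e0.
pose B := `|fx z| + `|gy z| + `|fy z| + `|gx z| + 1.
have B1 : 1 <= B by rewrite /B lerDr !addr_ge0.
(* [norm_mulB] bounds the error of each of the two products; together they cost at most
   [2 * (k * B)], hence at most [e]. *)
pose k := Num.min 1 (e / (2 * B)).
have k0 : 0 < k by rewrite lt_min ltr01 /= divr_gt0 // mulr_gt0 //; lra.
have k1 : k <= 1 by rewrite ge_min lexx.
have kB : 2 * (k * B) <= e.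
  have : k <= e / (2 * B) by rewrite ge_min lexx orbT.
  rewrite ler_pdivlMr; last lra.
  lra.
have [_ _ _ cfx cfy] := Cf z Kz; have [_ _ _ cgx cgy] := Cg z Kz.
have : \forall q \near z, [/\ `|fx q - fx z| <= k, `|fy q - fy z| <= k,
    `|gx q - gx z| <= k & `|gy q - gy z| <= k].
  near=> q; split; rewrite distrC; near: q.
  - exact: (cvgr_dist_le _ _ cfx).
  - exact: (cvgr_dist_le _ _ cfy).
  - exact: (cvgr_dist_le _ _ cgx).
  - exact: (cvgr_dist_le _ _ cgy).
move=> /nbhs_ballP[r /= r0 rP].
have near_z (p q : R * R) h : ball z (r / 2) p -> h < r / 2 ->
    p.1 <= q.1 <= p.1 + h -> p.2 <= q.2 <= p.2 + h -> ball z r q.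
  case: p q z {rP Kz B B1 k k0 k1 kB cfx cfy cgx cgy} => [p1 p2] [q1 q2] [z1 z2].
  move=> [] /= zp1 zp2 hr /andP[h1 h2] /andP[h3 h4].
  have bE (u v k : R) : ball u k v = (`|u - v| < k) by rewrite -ball_normE.
  move: zp1 zp2; rewrite !bE !ltr_norml.
  move=> /andP[h5 h6] /andP[h7 h8].
  by split; rewrite /= bE ltr_norml; apply/andP; split; lra.
near=> p h => s t /= /andP[s0 sh] /andP[t0 th] Kp Kq.
have pz : ball z (r / 2) p.
  by near: p; apply: nbhsx_ballx; rewrite divr_gt0.
have hr : h < r / 2 by near: h; apply: nbhs_right_lt; rewrite divr_gt0.
rewrite (surjective_pairing p) in pz.
case: Kp Kq => [/= Kx Ky] [/= Kx' Ky'].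
move: (p.1) (p.2) Kx Ky Kx' Ky' pz => x y Kx Ky Kx' Ky' pz.
rewrite !in_itv /= in Kx Ky Kx' Ky'.
move/andP: Kx => [ax xb]; move/andP: Ky => [cy yd].
move/andP: Kx' => [ax' xb']; move/andP: Ky' => [cy' yd'].
have Kin u v : x <= u <= x + s -> y <= v <= y + t ->
    box a b c d (u, v) /\ ball z r (u, v).
  move=> /andP[h1 h2] /andP[h3 h4]; split.
    by split; rewrite /= in_itv /=; apply/andP; split; lra.
  by apply: (near_z _ _ _ pz hr); apply/andP; split => /=; lra.
have xs : x <= x + s by lra.
have yt : y <= y + t by lra.
have xx : x <= x <= x + s by rewrite lexx xs.
have yy : y <= y <= y + t by rewrite lexx yt.
have xxs : x <= x + s <= x + s by rewrite lexx xs.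
have yyt : y <= y + t <= y + t by rewrite lexx yt.
have [u1 hu1 E1] := @MVT_is_derive R
   (fun u => f (u, y)) (fun u => fx (u, y)) x (x + s) xs
   (fun u hu => let: And5 _ d1 _ _ _ := Cf (u, y) (Kin u y hu yy).1 in d1).
have [u2 hu2 E2] := @MVT_is_derive R
   (fun v => g (x + s, v)) (fun v => gy (x + s, v)) y (y + t) yt
   (fun v hv => let: And5 _ _ d1 _ _ := Cg (x + s, v) (Kin (x + s) v xxs hv).1 in d1).
have [u3 hu3 E3] := @MVT_is_derive R
   (fun v => f (x, v)) (fun v => fy (x, v)) y (y + t) yt
   (fun v hv => let: And5 _ _ d1 _ _ := Cf (x, v) (Kin x v xx hv).1 in d1).
have [u4 hu4 E4] := @MVT_is_derive R
   (fun u => g (u, y + t)) (fun u => gx (u, y + t)) x (x + s) xs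
   (fun u hu => let: And5 _ d1 _ _ _ := Cg (u, y + t) (Kin u (y + t) hu yyt).1 in d1).
have [n1 _ _ _] := rP _ (Kin _ _ hu1 yy).2.
have [_ _ _ n2] := rP _ (Kin _ _ xxs hu2).2.
have [_ n3 _ _] := rP _ (Kin _ _ xx hu3).2.
have [_ _ n4 _] := rP _ (Kin _ _ hu4 yyt).2.
rewrite /cell_sum E1 E2 E3 E4 !(addrC x s) !(addrC y t) !addrK.
rewrite (_ : _ - _ = (fx (u1, y) * gy (s + x, u2) -
  fy (x, u3) * gx (u4, t + y)) * (s * t)); last by ring.
apply: ler_wpM2r; first exact: mulr_ge0.
rewrite (addrC x s) in n2; rewrite (addrC y t) in n4.
have := norm_mulB n1 n2 k1; have := norm_mulB n3 n4 k1.
rewrite !ler_norml => /andP[m1 _] /andP[_ m2].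
have : k * (`|fy z| + `|gx z| + 1) + k * (`|fx z| + `|gy z| + 1) <= 2 * (k * B).
  rewrite /B -mulrDr mulrCA ler_pM2l //.
  have := normr_ge0 (fy z); have := normr_ge0 (gx z).
  have := normr_ge0 (fx z); have := normr_ge0 (gy z); lra.
lra.
Unshelve. all: by end_near. Qed.

Lemma sum_cell_sum (R : realType) (f g : R * R -> R) (x y : nat -> R) (n m : nat) :
  \sum_(0 <= i < n) \sum_(0 <= j < m) cell_sum f g (x i) (y j) (x i.+1) (y j.+1) =
  \sum_(0 <= i < n) f (x i, y 0%N) * (g (x i.+1, y 0%N) - g (x i, y 0%N))
  - \sum_(0 <= i < n) f (x i, y m) * (g (x i.+1, y m) - g (x i, y m))
  + \sum_(0 <= j < m) f (x n, y j) * (g (x n, y j.+1) - g (x n, y j))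
  - \sum_(0 <= j < m) f (x 0%N, y j) * (g (x 0%N, y j.+1) - g (x 0%N, y j)).
Proof.
(* The terms of the horizontal and of the vertical edges: [h] telescopes in [j] and [v] in [i]. *)
pose h i j := f (x i, y j) * (g (x i.+1, y j) - g (x i, y j)).
pose v i j := f (x i, y j) * (g (x i, y j.+1) - g (x i, y j)).
transitivity (\sum_(0 <= i < n) \sum_(0 <= j < m)
    (- (h i j.+1 - h i j) + (v i.+1 j - v i j))).
  by apply: eq_bigr => i _; apply: eq_bigr => j _; rewrite /cell_sum /h /v; ring.
under eq_bigr => i _ do rewrite big_split /= sumrN telescope_sumr // opprB.
rewrite big_split /= sumrB exchange_big /= -[RHS]addrA; congr (_ + _).
by under eq_bigr => i _ do rewrite telescope_sumr //; rewrite sumrB.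
Qed.

(** On every grid the boundary sum equals [K * L]: [g] does not vary along the bottom and the top,
    [f] vanishes on the left, and on the right [f] is [K] while the increments of [g] telescope to
    [L]. On a fine grid each cell contributes at most [m + e] times its area. *)
Lemma clamped_area_le (R : realType) (a b c d : R) (f g fx fy gx gy : R * R -> R)
    (K L m : R) :
  a < b -> c < d ->
  (forall p, box a b c d p -> C1_at f fx fy p) ->
  (forall p, box a b c d p -> C1_at g gx gy p) ->
  (forall y, c <= y <= d -> f (a, y) = 0 /\ f (b, y) = K) ->
  (forall x, a <= x <= b -> g (x, c) = 0 /\ g (x, d) = L) ->
  (forall p, box a b c d p -> fx p * gy p - fy p * gx p <= m) ->
  K * L <= m * ((b - a) * (d - c)).
Proof.
move=> ab cd Cf Cg fab gcd Jm.
apply/ler_addgt0Pr => e' e'0.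
pose e := e' / ((b - a) * (d - c)).
have A0 : 0 < (b - a) * (d - c) by rewrite mulr_gt0 // subr_gt0.
have e0 : 0 < e by rewrite divr_gt0.
have -> : m * ((b - a) * (d - c)) + e' = (m + e) * ((b - a) * (d - c)).
  by rewrite (mulrDl m e) /e divfK // gt_eqF.
have cK : compact (box a b c d) by apply: compact_setX; exact: segment_compact.
move/compact_near_coveringP/near_covering_withinP: cK => cK.
(* By compactness the local estimates share one bound [h] on the mesh. *)
have small : \forall h \near (0 : R)^'+, box a b c d `<=` (fun p => forall s t,
    0 <= s <= h -> 0 <= t <= h -> box a b c d (p.1 + s, p.2 + t) ->
    cell_sum f g p.1 p.2 (p.1 + s) (p.2 + t) <= (m + e) * (s * t)).
  apply: cK.
  move=> z Kz; apply: filterS (cell_sum_le Cf Cg Kz e0).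
  move=> [p h] /= cell_le Kp s t sh th Kq.
  apply: le_trans (_ : (fx z * gy z - fy z * gx z + e) * (s * t) <= _); last first.
    move/andP: sh => [s0 _]; move/andP: th => [t0 _].
    apply: ler_wpM2r; first exact: mulr_ge0.
    by rewrite lerD2r; apply: Jm.
  exact: cell_le.
have [h [h0 hP]] : exists h : R, 0 < h /\ box a b c d `<=` (fun p => forall s t,
    0 <= s <= h -> 0 <= t <= h -> box a b c d (p.1 + s, p.2 + t) ->
    cell_sum f g p.1 p.2 (p.1 + s) (p.2 + t) <= (m + e) * (s * t)).
  near (0 : R)^'+ => h; exists h; split; near: h; [exact: nbhs_right_gt|exact: small].
have [N N0 [Ns Nt]] : exists2 N : nat, (0 < N)%N &
    (b - a) / N%:R <= h /\ (d - c) / N%:R <= h.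
  (* One [N] serves both directions, since it exceeds the sum of the two side lengths divided by
     [h]. *)
  exists (Num.truncn (((b - a) + (d - c)) / h)).+1 => //.
  have : ((b - a) + (d - c)) / h < (Num.truncn (((b - a) + (d - c)) / h)).+1%:R.
    by apply: truncnS_gt.
  rewrite ltr_pdivrMr // => lt.
  by split; rewrite ler_pdivrMr ?ltr0n // mulrC; apply: ltW; apply: le_lt_trans lt; lra.
have NR : 0 < N%:R :> R by rewrite ltr0n.
set s := _ / _ in Ns; set t := _ / _ in Nt.
have s0 : 0 <= s by rewrite divr_ge0 // ?ltW // subr_gt0.
have t0 : 0 <= t by rewrite divr_ge0 // ?ltW // subr_gt0.
have Es : N%:R * s = b - a by rewrite /s mulrC divfK // gt_eqF.
have Et : N%:R * t = d - c by rewrite /t mulrC divfK // gt_eqF.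
pose x i : R := a + i%:R * s; pose y i : R := c + i%:R * t.
have x0 : x 0%N = a by rewrite /x mul0r addr0.
have y0 : y 0%N = c by rewrite /y mul0r addr0.
have xN : x N = b by rewrite /x Es; ring.
have yN : y N = d by rewrite /y Et; ring.
have xS i : x i.+1 = x i + s by rewrite /x -natr1; ring.
have yS i : y i.+1 = y i + t by rewrite /y -natr1; ring.
have xab i : (i <= N)%N -> a <= x i <= b.
  move=> iN; rewrite -[in X in _ <= _ <= X]xN /x lerDl mulr_ge0 //= lerD2l.
  by rewrite ler_wpM2r // ler_nat.
have ycd i : (i <= N)%N -> c <= y i <= d.
  move=> iN; rewrite -[in X in _ <= _ <= X]yN /y lerDl mulr_ge0 //= lerD2l.
  by rewrite ler_wpM2r // ler_nat.
have sumE := sum_cell_sum f g x y N N.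
have {sumE} : \sum_(0 <= i < N) \sum_(0 <= j < N)
    cell_sum f g (x i) (y j) (x i.+1) (y j.+1) = K * L.
  rewrite sumE x0 y0 xN yN.
  rewrite [X in X - _ + _ - _]big1_seq; last first.
    move=> i; rewrite mem_index_iota => /= iN.
    by rewrite (gcd _ (xab i (ltnW iN))).1 (gcd _ (xab i.+1 iN)).1 subrr mulr0.
  rewrite [X in _ - X + _ - _]big1_seq; last first.
    move=> i; rewrite mem_index_iota => /= iN.
    by rewrite (gcd _ (xab i (ltnW iN))).2 (gcd _ (xab i.+1 iN)).2 subrr mulr0.
  rewrite [X in _ - X]big1_seq; last first.
    move=> i; rewrite mem_index_iota => /= iN.
    by rewrite (fab _ (ycd i (ltnW iN))).1 mul0r.
  rewrite subrr add0r subr0.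
  under eq_big_seq => i.
    rewrite mem_index_iota => /= iN; rewrite (fab _ (ycd i (ltnW iN))).2; over.
  rewrite -mulr_sumr (telescope_sumr (fun j => g (b, y j))) // y0 yN.
  have bab : a <= b <= b by rewrite lexx ltW.
  by rewrite (gcd _ bab).1 (gcd _ bab).2 subr0.
move=> <-.
apply: le_trans (_ : \sum_(0 <= i < N) \sum_(0 <= j < N) (m + e) * (s * t) <= _).
  rewrite big_seq [leRHS]big_seq; apply: ler_sum => i.
  rewrite mem_index_iota => /= iN.
  rewrite big_seq [leRHS]big_seq; apply: ler_sum => j.
  rewrite mem_index_iota => /= jN.
  rewrite xS yS; apply: (hP (x i, y j)).
  - by split => /=; rewrite in_itv /=; [apply: xab|apply: ycd]; exact: ltnW.
  - by rewrite s0.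
  - by rewrite t0.
  - by split => /=; rewrite in_itv /= -?xS -?yS; [apply: xab|apply: ycd].
rewrite !sumr_const_nat subn0 -mulrnA -mulr_natl natrM -Es -Et.
by move: (N%:R : R) => n; rewrite le_eqVlt; apply/orP; left; apply/eqP; ring.
Unshelve. all: by end_near. Qed.

(** * The C^1 clamp and the area inequality *)

(** Meant for the piecewise quadratic [clamp], where one estimate also covers the break points. The
    difference quotient, completed by [a] at [x], is Caratheodory's slope, and the bound makes it
    continuous at [x]. *)
Lemma is_derive_quadratic (R : realType) (f : R -> R) (x a C : R) :
  (forall z, `|f z - f x - a * (z - x)| <= C * (z - x) ^+ 2) ->
  is_derive x 1 f a.
Proof.
move=> fC; apply/is_derive1_caratheodory.
exists (fun z => if z == x then a else (f z - f x) / (z - x)); split.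
- move=> z; have [->|zx] := eqVneq z x; first by rewrite !subrr mulr0.
  by rewrite divfK // subr_eq0.
- apply/cvgrPdist_le => /= e e0; rewrite eqxx.
  have C1 : 0 < `|C| + 1 by rewrite ltr_wpDl.
  have : \forall z \near x, `|x - z| < e / (`|C| + 1).
    have d0 : 0 < e / (`|C| + 1) by rewrite divr_gt0.
    by have := nbhsx_ballx x _ d0; rewrite -ball_normE.
  apply: filterS => z; rewrite ltr_pdivlMr // => zx.
  have [_|zx0] := eqVneq z x; first by rewrite subrr normr0 ltW.
  have zx1 : 0 < `|z - x| by rewrite normr_gt0 subr_eq0.
  rewrite -(ler_pM2r zx1) -normrM mulrBl divfK ?subr_eq0 // distrC.
  apply: le_trans (fC z) _; rewrite -real_normK ?num_real // expr2 mulrA.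
  rewrite ler_pM2r //; apply: le_trans (ltW zx); rewrite mulrC distrC ler_wpM2l //.
  by rewrite (le_trans (ler_norm C)) // lerDl.
- by rewrite eqxx.
Qed.

(* Antiderivative of the trapezoid of height 1 supported on [0, w] with ramps
   of length h: a C^1 clamp, equal to 0 before 0 and to w - h after w. *)
Definition clamp (R : realType) (w h t : R) : R :=
  (t * `|t| - (t - h) * `|t - h| - (t - (w - h)) * `|t - (w - h)|
   + (t - w) * `|t - w|) / (4 * h) + (w - h) / 2.

Definition clamp' (R : realType) (w h t : R) : R :=
  (`|t| - `|t - h| - `|t - (w - h)| + `|t - w|) / (2 * h).

(** The derivative 2 |x| of x |x| is 2-Lipschitz, hence the constant 1 in the Taylor remainder. Once
    the sign of [x * z] is known, every case is linear in the squares and products. *)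
Lemma mul_norm_quadratic (R : realType) (x z : R) :
  `|z * `|z| - x * `|x| - 2 * `|x| * (z - x)| <= (z - x) ^+ 2.
Proof.
have xx := sqr_ge0 x; have zz := sqr_ge0 z; have zx := sqr_ge0 (z - x);
rewrite !expr2 in xx zz zx *.
have [x0|x0] := ger0P x; have [z0|z0] := ger0P z;
  [have xz := mulr_ge0 x0 z0|have xz := mulr_ge0_le0 x0 (ltW z0)
  |have xz := mulr_le0_ge0 (ltW x0) z0|have xz := mulr_le0 (ltW x0) (ltW z0)];
  by rewrite ler_norml; apply/andP; split; lra.
Qed.

Lemma is_derive_clamp (R : realType) (w h t : R) : 0 < h ->
  is_derive t 1 (clamp w h) (clamp' w h t).
Proof.
move=> h0; apply: (@is_derive_quadratic _ _ _ _ (1 / h)) => z.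
have h4 : 0 < 4 * h by rewrite mulr_gt0.
(* [d k] is the Taylor remainder of the term with break point [k]; four of them over [4 * h] give
   the constant [1 / h] above. *)
pose d (k : R) := (z - k) * `|z - k| - (t - k) * `|t - k| - 2 * `|t - k| * (z - t).
have dle k : `|d k| <= (z - t) ^+ 2.
  have := mul_norm_quadratic (t - k) (z - k).
  by rewrite (_ : z - k - (t - k) = z - t) //; ring.
have -> : clamp w h z - clamp w h t - clamp' w h t * (z - t) =
    (d 0 - d h - d (w - h) + d w) / (4 * h).
  rewrite /clamp /clamp' /d !subr0.
  by field; rewrite gt_eqF.
rewrite normrM [X in _ * X]ger0_norm ?invr_ge0 ?(ltW h4) // ler_pdivrMr //.
have -> : 1 / h * (z - t) ^+ 2 * (4 * h) = 4 * (z - t) ^+ 2.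
  by field; rewrite gt_eqF.
have := dle 0; have := dle h; have := dle (w - h); have := dle w.
rewrite !ler_norml => /andP[? ?] /andP[? ?] /andP[? ?] /andP[? ?].
by apply/andP; split; lra.
Qed.

Lemma continuous_clamp' (R : realType) (w h : R) : continuous (clamp' w h).
Proof.
move=> t; apply: cvgMr_tmp; apply: cvgD; first apply: cvgB; first apply: cvgB.
- by apply: cvg_norm; exact: cvg_id.
- by apply: cvg_norm; apply: cvgB; [exact: cvg_id|exact: cvg_cst].
- by apply: cvg_norm; apply: cvgB; [exact: cvg_id|exact: cvg_cst].
- by apply: cvg_norm; apply: cvgB; [exact: cvg_id|exact: cvg_cst].
Qed.

Lemma clamp'_itv (R : realType) (w h t : R) : 0 < h -> 2 * h <= w ->
  0 <= clamp' w h t <= 1.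
Proof.
move=> h0 hw; have h2 : 0 < 2 * h by rewrite mulr_gt0.
rewrite /clamp' ler_pdivrMr // mul1r ler_pdivlMr // mul0r.
have [a|a] := ger0P t; have [b|b] := ger0P (t - h);
have [c|c] := ger0P (t - (w - h)); have [d|d] := ger0P (t - w); lra.
Qed.

Lemma clamp_le0 (R : realType) (w h t : R) : 0 < h -> 2 * h <= w -> t <= 0 ->
  clamp w h t = 0.
Proof.
move=> h0 hw t0; rewrite /clamp !ler0_norm; try lra.
by field; rewrite gt_eqF.
Qed.

Lemma clamp_ge (R : realType) (w h t : R) : 0 < h -> 2 * h <= w -> w <= t ->
  clamp w h t = w - h.
Proof.
move=> h0 hw t0; rewrite /clamp !ger0_norm; try lra.
by field; rewrite gt_eqF.
Qed.

Lemma C1_at_clamp (R : realType) (w h k : R) (u ux uy : R * R -> R) (p : R * R) :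
  0 < h -> C1_at u ux uy p ->
  C1_at (fun q => clamp w h (u q - k)) (fun q => clamp' w h (u q - k) * ux q)
    (fun q => clamp' w h (u q - k) * uy q) p.
Proof.
case: p => p1 p2 h0 [cu du1 du2 cux cuy].
have sh (f : R -> R) (x df : R) : is_derive x 1 f df ->
    is_derive x 1 (fun x => f x - k) df.
  by move=> fd; apply: is_derive_eq; rewrite subr0.
have cuk : {for (p1, p2), continuous (fun q => u q - k)}.
  by apply: cvgB; [exact: cu|exact: cvg_cst].
have cc : {for (p1, p2), continuous (fun q => clamp' w h (u q - k))}.
  by apply: (@continuous_comp _ _ _ (fun q => u q - k)) => //; exact: continuous_clamp'.
split.
- apply: (@continuous_comp _ _ _ (fun q => u q - k)) => //.
  apply/differentiable_continuous/derivable1_diffP.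
  exact: (@ex_derive _ _ _ _ _ _ _ (is_derive_clamp w _ h0)).
- exact: (is_derive1_comp (is_derive_clamp w _ h0) (sh _ _ _ du1)).
- exact: (is_derive1_comp (is_derive_clamp w _ h0) (sh _ _ _ du2)).
- by apply: cvgM.
- by apply: cvgM.
Qed.

(* Clamping both coordinates makes the map carry opposite sides of the
   rectangle into opposite sides of a rectangle of size about V x W, and it can
   only decrease the absolute value of the Jacobian. *)
Lemma besicovitch (R : realType) (a b c d : R) (u v ux uy vx vy : R * R -> R)
    (k l V W m : R) :
  a < b -> c < d -> 0 < V -> 0 < W ->
  (forall p, box a b c d p -> C1_at u ux uy p) ->
  (forall p, box a b c d p -> C1_at v vx vy p) ->
  (forall y, c <= y <= d -> u (a, y) <= k /\ k + V <= u (b, y)) ->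
  (forall x, a <= x <= b -> v (x, c) <= l /\ l + W <= v (x, d)) ->
  (forall p, box a b c d p -> `|ux p * vy p - uy p * vx p| <= m) ->
  V * W <= m * ((b - a) * (d - c)).
Proof.
move=> ab cd V0 W0 Cu Cv uab vcd Jm.
(* Ramps of length [h] shrink the target rectangle to sides [V - h] and [W - h]; the loss disappears
   as [h] tends to 0. *)
have step h : 0 < h -> 2 * h <= V -> 2 * h <= W ->
    (V - h) * (W - h) <= m * ((b - a) * (d - c)).
  move=> h0 hV hW.
  apply: (clamped_area_le ab cd (fun p Kp => C1_at_clamp V k h0 (Cu p Kp))
    (fun p Kp => C1_at_clamp W l h0 (Cv p Kp))).
  - by move=> y /uab[ua ub]; split; [apply: clamp_le0|apply: clamp_ge] => //; lra.
  - by move=> x /vcd[va vb]; split; [apply: clamp_le0|apply: clamp_ge] => //; lra.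
  - move=> p /Jm J.
    have /andP[s0 s1] := clamp'_itv (u p - k) h0 hV.
    have /andP[t0 t1] := clamp'_itv (v p - l) h0 hW.
    set s := clamp' _ _ _ in s0 s1 *; set t := clamp' _ _ _ in t0 t1 *.
    have -> : s * ux p * (t * vy p) - s * uy p * (t * vx p) =
        (s * t) * (ux p * vy p - uy p * vx p) by ring.
    apply: le_trans (ler_norm _) _; rewrite normrM (ger0_norm (mulr_ge0 s0 t0)).
    by apply: le_trans J; rewrite ler_piMl // mulr_ile1.
apply/ler_addgt0Pr => e e0.
(* The first two bounds make [r] admissible in [step]; the third gives [r * (V + W) <= e], which
   absorbs the loss in [(V - r) * (W - r)]. *)
pose r := Num.min (Num.min (V / 2) (W / 2)) (e / (V + W)).
have VW : 0 < V + W by rewrite addr_gt0.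
have r0 : 0 < r by rewrite !lt_min !divr_gt0.
have hV : r <= V / 2 by rewrite !ge_min lexx.
have hW : r <= W / 2 by rewrite !ge_min lexx orbT.
have : r <= e / (V + W) by rewrite !ge_min lexx orbT.
rewrite ler_pdivlMr // => he.
have rV : 2 * r <= V by lra.
have rW : 2 * r <= W by lra.
have := step r r0 rV rW.
have := mulr_gt0 r0 r0.
nra.
Qed.

(** * Directional derivatives and restriction to planes *)

Lemma is_derive_line (R : realType) (V : normedModType R) (f : V -> R)
    (x a : V) (s : R) :
  differentiable f (x + s *: a) ->
  is_derive s 1 (fun s => f (x + s *: a)) ('D_a f (x + s *: a)).
Proof.
move=> df.
have E : (fun h : R => h^-1 *: (((fun s => f (x + s *: a)) \o shift s) (h *: 1) -
      f (x + s *: a))) =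
    (fun h => h^-1 *: ((f \o shift (x + s *: a)) (h *: a) - f (x + s *: a))).
  apply/funext => h /=; congr (_ *: (f _ - _)).
  by rewrite /GRing.scale /= mulr1 -/(GRing.scale _ _) scalerDl addrCA.
split; first by rewrite /derivable E; exact: diff_derivable.
by rewrite /derive E.
Qed.

(** Pulls a smooth function back along the affine map of a frame, to the plane [R * R] on which
    [besicovitch] is stated. *)
Lemma C1_at_plane (R : realType) (n : nat) (U : set 'rV[R]_n)
    (f : 'rV[R]_n -> R) (x a b : 'rV[R]_n) (q : R * R) :
  Csmooth_on U f -> U (x + q.1 *: a + q.2 *: b) ->
  C1_at (fun q => f (x + q.1 *: a + q.2 *: b))
    (fun q => 'D_a f (x + q.1 *: a + q.2 *: b))
    (fun q => 'D_b f (x + q.1 *: a + q.2 *: b)) q.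
Proof.
move=> sf Uq; have [df Df] := sf 1%N; have dfq := df _ Uq.
have cq : {for q, continuous (fun q : R * R => x + q.1 *: a + q.2 *: b)}.
  have c1 : {for q, continuous (fun q : R * R => q.1 *: a)}.
    by apply: (cvgZ _ (cvg_cst a)); case: (q) => q1 q2; exact: cvg_fst.
  have c2 : {for q, continuous (fun q : R * R => q.2 *: b)}.
    by apply: (cvgZ _ (cvg_cst b)); case: (q) => q1 q2; exact: cvg_snd.
  exact: (cvgD (cvgD (cvg_cst x) c1) c2).
have cD v : {for q, continuous (fun q : R * R => 'D_v f (x + q.1 *: a + q.2 *: b))}.
  apply: (@continuous_comp _ _ _ (fun q : R * R => x + q.1 *: a + q.2 *: b)
    (fun y => 'D_v f y)) => //.
  by apply: Df; rewrite in_setE.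
split => //.
- apply: (@continuous_comp _ _ _ (fun q : R * R => x + q.1 *: a + q.2 *: b) f) => //.
  exact: differentiable_continuous.
- have := @is_derive_line _ _ f (x + q.2 *: b) a q.1.
  rewrite addrAC => /(_ dfq); congr is_derive.
  by apply/funext => s; rewrite addrAC.
- exact: (@is_derive_line _ _ f (x + q.1 *: a) b q.2 dfq).
Qed.

Lemma diff_plane (R : realType) (V : normedModType R) (f : V -> R)
    (x a b : V) (t u : R) :
  differentiable f x ->
  'd f x (t *: a + u *: b) = t * 'D_a f x + u * 'D_b f x.
Proof. by move=> df; rewrite linearD !linearZ /= -!deriveE. Qed.

Lemma derive_rV2 (R : realType) (f : 'rV[R]_2 -> R) (x v : 'rV[R]_2) :
  differentiable f x ->
  'D_v f x = v 0 0 * 'D_(delta_mx 0 0) f x + v 0 1 * 'D_(delta_mx 0 1) f x.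
Proof.
move=> df; rewrite !deriveE // {1}[v]row_sum_delta linear_sum.
by rewrite big_ord_recl big_ord1 /= !linearZ /= (_ : lift ord0 ord0 = 1) //; exact/val_inj.
Qed.

(** The bracket is alternating and bilinear in [(a, b)], so in dimension two leaving the standard
    frame costs a determinant. *)
Lemma bracket_rV2 (R : realType) (f g : 'rV[R]_2 -> R) (x a b : 'rV[R]_2) :
  differentiable f x -> differentiable g x ->
  'D_a f x * 'D_b g x - 'D_b f x * 'D_a g x =
  (a 0 0 * b 0 1 - a 0 1 * b 0 0) *
  ('D_(delta_mx 0 0) f x * 'D_(delta_mx 0 1) g x
   - 'D_(delta_mx 0 1) f x * 'D_(delta_mx 0 0) g x).
Proof.
move=> df dg.
rewrite (derive_rV2 a df) (derive_rV2 b df) (derive_rV2 a dg) (derive_rV2 b dg).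
move: (a 0 0) (a 0 1) (b 0 0) (b 0 1) ('D_(delta_mx 0 0) f x)
  ('D_(delta_mx 0 1) f x) ('D_(delta_mx 0 0) g x) ('D_(delta_mx 0 1) g x).
by move=> *; ring.
Qed.

(** * A lower bound for the Jacobian under uniform perturbation *)

(** Provides the tolerance of [poisson_inf_ge]: [1 + k] allows for the variation of the coefficient
    of the form, [1 - 2 * k] for the loss in [jacobian_lower_bound]. *)
Lemma small_gap (R : realFieldType) (q : R) : 0 <= q -> q < 1 ->
  exists k, [/\ 0 < k, 2 * k < 1 & q * (1 + k) < (1 - 2 * k) ^+ 2].
Proof. by move=> q0 q1; exists ((1 - q) / 8); split; nra. Qed.

Lemma approx_error (R : realFieldType) (y z y0 t k e r : R) :
  `|y - z| <= e * r -> `|y - y0 - t| <= k -> k <= e * r ->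
  `|z - y0 - t| <= 2 * e * r.
Proof.
rewrite !ler_norml => /andP[h1 h2] /andP[h3 h4] ker.
by apply/andP; split; lra.
Qed.

(** To first order at [x], [(f, g)] is a translation in the coordinates of the frame [(a, b)]. On a
    small square of side [2 * r] the perturbed functions differ from it by at most [2 * e * r], so
    [besicovitch] compares a square of side [2 * r - 4 * e * r] with the original one. [P] lets the
    caller keep to points where another local estimate holds. *)
Lemma jacobian_lower_bound (R : realType) (U : set 'rV[R]_2)
    (f g : 'rV[R]_2 -> R) (x a b : 'rV[R]_2) (P : 'rV[R]_2 -> Prop) (e : R) :
  open U -> U x -> Csmooth_on U f -> Csmooth_on U g ->
  'D_a f x = 1 -> 'D_b f x = 0 -> 'D_a g x = 0 -> 'D_b g x = 1 ->
  (\forall y \near x, P y) -> 0 < e -> 2 * e < 1 ->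
  exists2 r, 0 < r & forall f' g' : 'rV[R]_2 -> R,
    Csmooth_on U f' -> Csmooth_on U g' ->
    (forall y, U y -> `|f y - f' y| <= r) ->
    (forall y, U y -> `|g y - g' y| <= r) ->
    forall m, (forall y, U y -> P y ->
      `|'D_a f' y * 'D_b g' y - 'D_b f' y * 'D_a g' y| <= m) ->
    (1 - 2 * e) ^+ 2 <= m.
Proof.
move=> oU Ux sf sg fa fb ga gb Px e0 e1.
have dfx : differentiable f x by have [+ _] := sf 1%N; exact.
have dgx : differentiable g x by have [+ _] := sg 1%N; exact.
(* For coordinates at most [r] in absolute value, [r * C] bounds the norm of [t *: a + u *: b], so
   the Taylor remainder with constant [e / C] is at most [e * r]. *)
pose C := `|a| + `|b| + 1.
have C0 : 0 < C by rewrite ltr_wpDl // addr_ge0.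
have eC : 0 < e / C by rewrite divr_gt0.
have : \forall h \near (0 : 'rV[R]_2), [/\ U (x + h), P (x + h),
    `|f (x + h) - f x - 'd f x h| <= e / C * `|h| &
    `|g (x + h) - g x - 'd g x h| <= e / C * `|h|].
  have sh (Q : 'rV[R]_2 -> Prop) : (\forall y \near x, Q y) ->
      \forall h \near (0 : 'rV[R]_2), Q (x + h).
    have : {for 0, continuous (fun h : 'rV[R]_2 => x + h)}.
      exact: (continuousD (@cst_continuous _ _ x 0) cvg_id).
    by rewrite /prop_for /continuous_at addr0; apply.
  have app (k : 'rV[R]_2 -> R) : differentiable k x ->
      \forall h \near (0 : 'rV[R]_2), `|k (x + h) - k x - 'd k x h| <= e / C * `|h|.
    move=> dk; have E := diff_locallyxC dk.
    near=> h; rewrite E -[X in `|X|]addrA -opprD addrAC subrr add0r.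
    by near: h; apply: littleoP.
  have xU : \forall y \near x, U y by apply: open_nbhs_nbhs.
  apply: filterS2 (filterI (sh _ xU) (sh _ Px)) (filterI (app _ dfx) (app _ dgx)).
  by move=> h [? ?] [? ?]; split.
move=> /nbhs_ballP[s /= s0 sP].
pose r := s / (2 * C).
have r0 : 0 < r by rewrite divr_gt0 // mulr_gt0.
have in_ball t u : - r <= t <= r -> - r <= u <= r ->
    `|t *: a + u *: b| <= r * C /\ ball 0 s (t *: a + u *: b).
  rewrite -!ler_norml => tr ur.
  have le : `|t *: a + u *: b| <= r * C.
    apply: le_trans (ler_normD _ _) _; rewrite !normrZ /C 2!mulrDr mulr1.
    have := ler_wpM2r (normr_ge0 a) tr; have := ler_wpM2r (normr_ge0 b) ur.
    lra.
  split => //; rewrite -ball_normE /= sub0r normrN; apply: le_lt_trans le _.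
  have -> : r * C = s / 2 by rewrite /r; field; rewrite gt_eqF.
  lra.
have lin t u : 'd f x (t *: a + u *: b) = t /\ 'd g x (t *: a + u *: b) = u.
  rewrite (diff_plane a b t u dfx) (diff_plane a b t u dgx) fa fb ga gb.
  by rewrite !(mulr0, mulr1, addr0, add0r).
(* The allowed perturbation has the size of the Taylor remainder on the square; the two add up to
   [2 * e * r]. *)
exists (e * r) => [|f' g' sf' sg' ff' gg' m Jm]; first by rewrite mulr_gt0.
have err t u : - r <= t <= r -> - r <= u <= r ->
    `|f' (x + t *: a + u *: b) - f x - t| <= 2 * e * r /\
    `|g' (x + t *: a + u *: b) - g x - u| <= 2 * e * r.
  move=> tr ur; have [hle /sP[Uh _]] := in_ball t u tr ur.
  have [-> ->] := lin t u; rewrite addrA in Uh; rewrite addrA.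
  have : e / C * `|t *: a + u *: b| <= e * r.
    by rewrite mulrAC ler_pdivrMr // -mulrA ler_pM2l // mulrC.
  move=> kr fh gh; split; first exact: approx_error (ff' _ Uh) fh kr.
  exact: approx_error (gg' _ Uh) gh kr.
have inU p : box (- r) r (- r) r p -> U (x + p.1 *: a + p.2 *: b) /\
    P (x + p.1 *: a + p.2 *: b).
  case: p => t u [/=]; rewrite !in_itv /= => tr ur.
  by have [_ /sP[]] := in_ball t u tr ur; rewrite !addrA.
(* The gap between the upper bound [f x - r + 2 * e * r] for [f'] on the left edge and the lower
   bound [f x + r - 2 * e * r] on the right edge; likewise for [g']. *)
have V0 : 0 < 2 * r - 4 * e * r.
  have := mulr_gt0 r0 (_ : 0 < 1 - 2 * e); rewrite subr_gt0 => /(_ e1); lra.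
have rr : - r < r by lra.
have rN : - r <= - r <= r by rewrite lexx ltW.
have rP : - r <= r <= r by rewrite lexx ltW.
have H := @besicovitch R (- r) r (- r) r _ _ _ _ _ _
  (f x - r + 2 * e * r) (g x - r + 2 * e * r) _ _ m rr rr V0 V0
  (fun p bp => C1_at_plane sf' (inU p bp).1)
  (fun p bp => C1_at_plane sg' (inU p bp).1).
have : (2 * r - 4 * e * r) * (2 * r - 4 * e * r) <= m * ((r - - r) * (r - - r)).
  apply: H.
  - move=> u ur /=; have [+ _] := err _ _ rN ur; have [+ _] := err _ _ rP ur.
    by rewrite !ler_norml => /andP[h1 h2] /andP[h3 h4]; split; lra.
  - move=> t tr /=; have [_ +] := err _ _ tr rN; have [_ +] := err _ _ tr rP.
    by rewrite !ler_norml => /andP[h1 h2] /andP[h3 h4]; split; lra.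
  - by move=> p bp; have [] := inU p bp; exact: Jm.
have -> : (2 * r - 4 * e * r) * (2 * r - 4 * e * r) =
    (1 - 2 * e) ^+ 2 * (4 * (r * r)) by ring.
have -> : m * ((r - - r) * (r - - r)) = m * (4 * (r * r)) by ring.
by rewrite ler_pM2r // mulr_gt0 // mulr_gt0.
Unshelve. all: by end_near. Qed.

(** * Passage to the manifold and conclusion *)

(** In a chart the Jacobian is minus the bracket times the coefficient of [w]. In the frame dual to
    (dF, dG) at [p], a bracket of sup norm below [m] would keep the Jacobian of [(F', G')] near [p]
    at most [1 + k] times m / |{F, G}(p)|, against [jacobian_lower_bound]. *)
Lemma poisson_inf_ge (R : realType) (M : topologicalType)
    (A : smooth_manifold R 2 M) (w : symplectic_form A) (F G : M -> R)
    (p : M) (m : R) :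
  smooth_fun A F -> smooth_fun A G -> m < `|poisson w F G p| ->
  \forall e \near (0 : R)^'+, (m%:E <= poisson_inf w F G e)%E.
Proof.
move=> sF sG mH.
have sup_ge0 (H : M -> R) : (0 <= supnorm H)%E by apply: ereal_sup_ubound; left.
have sup_ge (H : M -> R) q : (`|H q|%:E <= supnorm H)%E.
  by apply: ereal_sup_ubound; right; exists q.
have [m0|m0] := ltP m 0.
  near=> e; apply: le_ereal_inf_tmp => _ [F' [G' [_ _ _ _ ->]]].
  by apply: le_trans (sup_ge0 _); rewrite lee_fin ltW.
have [c Ac cp] := atlas_cover A p.
pose U := chart_cod c; pose x := c p.
have oU : open U by exact: chart_cod_open.
have Ux : U x by exists p.
have Ex : chart_inv c x = p by rewrite /x chart_mapK ?in_setE.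
pose f := F \o chart_inv c; pose g := G \o chart_inv c.
have sf : Csmooth_on U f := sF c Ac.
have sg : Csmooth_on U g := sG c Ac.
pose e0 : 'rV[R]_2 := delta_mx 0 0; pose e1 : 'rV[R]_2 := delta_mx 0 1.
(* Entry (0, 1) of the matrix identity that defines the bracket. *)
have jac F' G' y : smooth_fun A F' -> smooth_fun A G' -> U y ->
    'D_e0 (F' \o chart_inv c) y * 'D_e1 (G' \o chart_inv c) y
    - 'D_e1 (F' \o chart_inv c) y * 'D_e0 (G' \o chart_inv c) y =
    - (poisson w F' G' (chart_inv c y) * w c (chart_inv c y) 0 1).
  move=> sF' sG' [q cq <-]; rewrite chart_mapK ?in_setE //.
  have /matrixP/(_ 0 1) := poissonP w sF' sG' Ac cq.
  rewrite mxE wedgeE [X in _ = X -> _]mxE => <-; rewrite opprK /dfun !mxE.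
  by congr (_ - _); rewrite mulrC.
have w0 : w c p 0 1 != 0.
  apply: contra (form_neq0 w Ac cp) => /eqP a0.
  by rewrite (alternating2E (form_alternating w Ac cp)) a0 scale0r.
have H0 : 0 < `|poisson w F G p| by exact: le_lt_trans mH.
pose D := 'D_e0 f x * 'D_e1 g x - 'D_e1 f x * 'D_e0 g x.
have DE : D = - (poisson w F G p * w c p 0 1) by rewrite /D jac // Ex.
have D0 : D != 0 by rewrite DE oppr_eq0 mulf_neq0 // -normr_gt0.
(* The frame dual to [dF, dG] at [p]. *)
pose a : 'rV[R]_2 := \row_i (if i == 0 then 'D_e1 g x / D else - 'D_e0 g x / D).
pose b : 'rV[R]_2 := \row_i (if i == 0 then - 'D_e1 f x / D else 'D_e0 f x / D).
have [dfU _] := sf 1%N; have [dgU _] := sg 1%N.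
have aE : a 0 0 = 'D_e1 g x / D /\ a 0 1 = - 'D_e0 g x / D by rewrite /a !mxE.
have bE : b 0 0 = - 'D_e1 f x / D /\ b 0 1 = 'D_e0 f x / D by rewrite /b !mxE.
have fgE : [/\ 'D_a f x = 1, 'D_b f x = 0, 'D_a g x = 0, 'D_b g x = 1 &
    a 0 0 * b 0 1 - a 0 1 * b 0 0 = D^-1].
  rewrite (derive_rV2 a (dfU x Ux)) (derive_rV2 b (dfU x Ux)).
  rewrite (derive_rV2 a (dgU x Ux)) (derive_rV2 b (dgU x Ux)) -/e0 -/e1.
  rewrite aE.1 aE.2 bE.1 bE.2; move: D0; rewrite /D.
  by move: ('D_e0 f x) ('D_e1 f x) ('D_e0 g x) ('D_e1 g x) => *; split; field.
have [fa fb ga gb abE] := fgE.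
have m1 : m / `|poisson w F G p| < 1 by rewrite ltr_pdivrMr // mul1r.
have m2 : 0 <= m / `|poisson w F G p| by rewrite divr_ge0 // ltW.
have [k [k0 k1 mk]] := small_gap m2 m1.
(* This enters [jacobian_lower_bound] as the predicate [P]. *)
have nw : \forall y \near x,
    `|w c (chart_inv c y) 0 1| <= (1 + k) * `|w c p 0 1|.
  have cw : w c (chart_inv c y) 0 1 @[y --> x] --> w c p 0 1.
    by rewrite -[in X in _ --> X]Ex; apply: (form_smooth w Ac 0 1 0%N); rewrite in_setE.
  have : \forall y \near x, `|w c p 0 1 - w c (chart_inv c y) 0 1| <= k * `|w c p 0 1|.
    by apply: (cvgr_dist_le _ _ cw); rewrite mulr_gt0 // normr_gt0.
  apply: filterS => y; rewrite distrC => le.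
  rewrite -[X in `|X|](subrK (w c p 0 1)).
  by apply: le_trans (ler_normD _ _) _; rewrite mulrDl mul1r addrC lerD2l.
have [r r0 rP] := jacobian_lower_bound oU Ux sf sg fa fb ga gb nw k0 k1.
near=> e; apply: le_ereal_inf_tmp => _ [F' [G' [sF' sG' FF' GG' ->]]].
have er : e <= r by near: e; exact: nbhs_right_le.
rewrite leNgt; apply/negP => Hm.
have dist (K K' : M -> R) : (supnorm (K \- K')%R < e%:E)%E ->
    forall y, U y -> `|(K \o chart_inv c) y - (K' \o chart_inv c) y| <= r.
  move=> KK' y _; apply: le_trans er; rewrite -lee_fin.
  by apply: le_trans (ltW KK'); exact: (sup_ge (K \- K') (chart_inv c y)).
suff : (1 - 2 * k) ^+ 2 <= m / `|poisson w F G p| * (1 + k) by rewrite leNgt mk.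
apply: (rP _ _ (sF' c Ac) (sG' c Ac) (dist _ _ FF') (dist _ _ GG')) => y Uy wy.
have dF' : differentiable (F' \o chart_inv c) y by have [+ _] := sF' c Ac 1%N; exact.
have dG' : differentiable (G' \o chart_inv c) y by have [+ _] := sG' c Ac 1%N; exact.
(* The frame has determinant [D^-1], so up to sign the Jacobian is the product of bracket and form
   coefficient at [y] for [(F', G')], divided by the same product at [p] for [(F, G)]. *)
rewrite (bracket_rV2 a b dF' dG') -/e0 -/e1.
rewrite jac // abE normrM normfV DE !normrN !normrM.
have Hy : `|poisson w F' G' (chart_inv c y)| <= m.
  by rewrite -lee_fin; apply: le_trans (sup_ge _ _) (ltW Hm).
rewrite ler_pdivrMl; last by rewrite mulr_gt0 // normr_gt0.
rewrite [leRHS](_ : _ = m * ((1 + k) * `|w c p 0 1|)); last first.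
  by field; rewrite gt_eqF.
exact: ler_pM.
Unshelve. all: by end_near. Qed.

Theorem theorem1p8 (R : realType) (M : topologicalType)
    (A : smooth_manifold R 2 M) (w : symplectic_form A) (F G : M -> R) :
  smooth_fun A F -> smooth_fun A G ->
  Upsilon w F G = supnorm (poisson w F G).
Proof.
move=> sF sG; apply/eqP; rewrite eq_le; apply/andP; split.
  (* The pair [(F, G)] itself is admissible for every positive [e]. *)
  apply: lime_le; first exact: is_cvg_poisson_inf.
  near=> e; apply: ereal_inf_lbound; exists F, G.
  have e0 : 0 < e by near: e; exact: nbhs_right_gt.
  have dist0 (K : M -> R) : (supnorm (K \- K)%R < e%:E)%E.
    apply: (@le_lt_trans _ _ 0%E); last by rewrite lte_fin.
    by apply: ge_ereal_sup => _ [->//|[p _ <-]] /=; rewrite subrr normr0.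
  by split.
have ge m p : m < `|poisson w F G p| -> (m%:E <= Upsilon w F G)%E.
  by move=> mp; apply: lime_ge; [exact: is_cvg_poisson_inf|exact: poisson_inf_ge mp].
(* The first case is the element 0 adjoined in [supnorm]. In the second it suffices to go just below
   each single value |{F, G}(p)|, which also covers an infinite supremum. *)
apply: ge_ereal_sup => _ [->|[p _ <-]].
  apply: lime_ge; first exact: is_cvg_poisson_inf.
  near=> e; apply: le_ereal_inf_tmp => _ [F' [G' [_ _ _ _ ->]]].
  by apply: ereal_sup_ubound; left.
apply/lee_subgt0Pr => e e0; rewrite -EFinB.
by apply: (ge _ p); rewrite ltrBlDr ltrDl.
Unshelve. all: by end_near. Qed.
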